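(* Let $\alpha_{mn}$ denote the infimum of the precision of the approximate solution over all $m$-dimensional integer knapsack problems in $n$ variables (as defined in the context), and let $\alpha_{1\infty} = \lim_{k\to\infty}\alpha_{1k}$. Then for every fixed positive integer $m$, $$\lim_{n\to\infty}\alpha_{mn} = \frac{\alpha_{1\infty}}{m}.$$
   Context: $\mathbb{Z}_+$ and $\mathbb{R}_+$ denote the sets of non-negative integers and non-negative reals. For $A = (a_{ij}) \in \mathbb{R}_+^{m\times n}$, $b = (b_i) \in \mathbb{R}_+^m$, put $L(A,b) = \{x \in \mathbb{Z}_+^n : Ax \le b\}$. For $c = (c_j)\in\mathbb{R}_+^n$, the integer $m$-dimensional knapsack problem is to maximize $cx = \sum_j c_j x_j$ over $x \in L(A,b)$. For $j = 1,\dots,n$ let $v^{(j)} \in L(A,b)$ be the point all of whose coordinates are $0$ except the $j$-th, which equals $v^{(j)}_j = \min_{i:\, a_{ij}>0} \lfloor b_i/a_{ij} \rfloor$. Let $V(A,b) = \{v^{(1)},\dots,v^{(n)}\}$. A point of $V(A,b)$ maximizing $cx$ over $V(A,b)$ is called an approximate solution, and the precision of the approximate solution is $$\alpha(A,b,c) = \frac{\max_{x\in V(A,b)} cx}{\max_{x\in L(A,b)} cx}.$$ Only instances for which this is well defined are considered: every column of $A$ has a positive entry (so $L(A,b)$ is finite) and $\max_{x\in L(A,b)} cx > 0$. Define $$\alpha_{mn} = \inf\{\alpha(A,b,c) : A\in\mathbb{R}_+^{m\times n},\ b\in\mathbb{R}_+^m,\ c\in\mathbb{R}_+^n\},$$ the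 infimum being over such instances. It is known from earlier literature that for $m=1$, $\alpha_{1n} = \delta_n/\varepsilon_n$ for $n\ge 1$, where $\delta_1=\varepsilon_1=1$, $\delta_n = \delta_{n-1}(\delta_{n-1}+1)$, $\varepsilon_n = 1 + \varepsilon_{n-1}(\delta_{n-1}+1)$; this sequence decreases monotonically to its limit $\alpha_{1\infty} = 0.591355492056890\dots$ *)

(* Defs.v *)
From HB Require Import structures.
From mathcomp Require Import all_boot all_order all_algebra.
From mathcomp Require Import all_classical all_reals all_analysis.

Set Implicit Arguments.
Unset Strict Implicit.
Unset Printing Implicit Defensive.

Import Order.TTheory GRing.Theory Num.Theory.
Import numFieldNormedType.Exports.

Local Open Scope classical_set_scope.
Local Open Scope ring_scope.

Definition natcV (R : realType) (n : nat) (x : 'cV[nat]_n) : 'cV[R]_n :=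
  map_mx (fun k : nat => k%:R) x.

(* L(A,b) *)
Definition feasible (R : realType) (m n : nat) (A : 'M[R]_(m, n))
    (b : 'cV[R]_m) : set 'cV[nat]_n :=
  [set x | forall i : 'I_m, (A *m natcV R x) i 0 <= b i 0].

Definition objective (R : realType) (n : nat) (c : 'rV[R]_n)
    (x : 'cV[nat]_n) : R :=
  (c *m natcV R x) 0 0.

(* min over {i : a_ij > 0} of floor(b_i / a_ij). The initial value of the
   iterated minimum is the maximum of the same family, so it does not affect
   the result when the family is nonempty. *)
Definition vcoord (R : realType) (m n : nat) (A : 'M[R]_(m, n))
    (b : 'cV[R]_m) (j : 'I_n) : nat :=
  let q := fun i : 'I_m => Num.truncn (b i 0 / A i j) in
  let q0 := (\max_(i < m | (0 < A i j)%R) q i)%N in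
  (\big[minn/q0]_(i < m | (0 < A i j)%R) q i)%N.

Definition vpoint (R : realType) (m n : nat) (A : 'M[R]_(m, n))
    (b : 'cV[R]_m) (j : 'I_n) : 'cV[nat]_n :=
  \col_(k < n) (if k == j then vcoord A b j else 0%N).

(* V(A,b) *)
Definition vpoints (R : realType) (m n : nat) (A : 'M[R]_(m, n))
    (b : 'cV[R]_m) : set 'cV[nat]_n :=
  range (vpoint A b).

(* The greatest element of S; the value is 0 if S has none. *)
Definition set_max (R : realType) (S : set R) : R :=
  xget 0 (S `&` ubound S).

Definition max_value (R : realType) (n : nat) (c : 'rV[R]_n)
    (S : set 'cV[nat]_n) : R :=
  set_max (objective c @` S).

(* alpha(A,b,c) *)
Definition precision (R : realType) (m n : nat) (A : 'M[R]_(m, n))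
    (b : 'cV[R]_m) (c : 'rV[R]_n) : R :=
  max_value c (vpoints A b) / max_value c (feasible A b).

Definition admissible (R : realType) (m n : nat) (A : 'M[R]_(m, n))
    (b : 'cV[R]_m) (c : 'rV[R]_n) : Prop :=
  [/\ forall i j, 0 <= A i j,
      forall i, 0 <= b i 0,
      forall j, 0 <= c 0 j,
      forall j, exists i, 0 < A i j &
      0 < max_value c (feasible A b)].

(* alpha_mn. For m = 0 or n = 0 there is no admissible instance and the
   infimum of the empty set is 0 by convention. *)
Definition alpha (R : realType) (m n : nat) : R :=
  inf [set r | exists (A : 'M[R]_(m, n)) (b : 'cV[R]_m) (c : 'rV[R]_n),
         admissible A b c /\ r = precision A b c].

Definition alpha1_infty (R : realType) : R := limn (alpha R 1).

(* Main.v *)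
Require Import Defs.
From mathcomp Require Import all_boot all_order all_algebra.
From mathcomp Require Import all_classical all_reals all_analysis.
Set Implicit Arguments.
Unset Strict Implicit.
Unset Printing Implicit Defensive.

Import Order.TTheory GRing.Theory Num.Theory.
Import numFieldNormedType.Exports.
Local Open Scope classical_set_scope.
Local Open Scope ring_scope.

(** The value [alpha R m n] is squeezed between [alpha R 1 n / m] and [alpha R 1 (n %/ m) / m].
    Lower bound ([alpha_lower]): the vertex coordinate of a column is decided by a single row, so
    grouping the columns by such rows splits the optimum into m one-row parts; [alpha R 1 n] times
    each part is at most the best vertex value. Upper bound ([alpha_upper]): m diagonal copies of a
    one-row instance multiply the optimum by at least m, whereas a vertex lives in one copy and
    gains nothing. For m = 1 the upper bound says that [alpha R 1] is nonincreasing, which gives its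
    convergence ([alpha1_cvg]). *)

(** * Coordinate formulas and vertex coordinates *)

Lemma objectiveE (R : realType) (n : nat) (c : 'rV[R]_n) (x : 'cV[nat]_n) :
  objective c x = \sum_j c 0 j * (x j 0)%:R.
Proof. by rewrite /objective mxE; apply: eq_bigr => j _; rewrite mxE. Qed.

Lemma feasibleE (R : realType) (m n : nat) (A : 'M[R]_(m, n)) (b : 'cV[R]_m)
    (x : 'cV[nat]_n) :
  feasible A b x <-> forall i, \sum_j A i j * (x j 0)%:R <= b i 0.
Proof.
have E i : (A *m natcV R x) i 0 = \sum_j A i j * (x j 0)%:R.
  by rewrite mxE; apply: eq_bigr => j _; rewrite mxE.
by split=> H i; have := H i; rewrite E.
Qed.

Lemma objective_vpoint (R : realType) (m n : nat) (A : 'M[R]_(m, n))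
    (b : 'cV[R]_m) (c : 'rV[R]_n) (j : 'I_n) :
  objective c (vpoint A b j) = c 0 j * (vcoord A b j)%:R.
Proof.
rewrite objectiveE (bigD1 j) //= mxE eqxx big1 ?addr0 // => k /negbTE kj.
by rewrite mxE kj mulr0.
Qed.

Lemma vcoord_le (R : realType) (m n : nat) (A : 'M[R]_(m, n)) (b : 'cV[R]_m)
    (i : 'I_m) (j : 'I_n) :
  0 < A i j -> (vcoord A b j <= Num.truncn (b i 0 / A i j)%R)%N.
Proof.
move=> Aij; rewrite /vcoord; set q0 := (\max_(_ < _ | _) _)%N.
(* Induction on the index list, using only that [i] occurs in it; the initial value [q0] is
   arbitrary here. *)
elim: (index_enum _) (mem_index_enum i) => //= k s IH.
rewrite inE big_cons => /predU1P[<-|/IH is_le]; first by rewrite Aij geq_minl.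
by case: ifP => // _; exact: leq_trans (geq_minr _ _) is_le.
Qed.

(** Being the quotient of some row with positive entry is stable under [minn], and the initial value
    has this property since a maximum over a nonempty family is attained. *)
Lemma vcoord_attained (R : realType) (m n : nat) (A : 'M[R]_(m, n))
    (b : 'cV[R]_m) (j : 'I_n) :
  (exists i, 0 < A i j) ->
  exists2 i, 0 < A i j & vcoord A b j = Num.truncn (b i 0 / A i j).
Proof.
move=> [i0 Ai0].
pose Q k := exists2 i, 0 < A i j & k = Num.truncn (b i 0 / A i j).
apply: (@big_ind _ Q) => [|x y Qx Qy|i Ai]; last by exists i.
  have [|i] := @eq_bigmax_cond _ [pred i | 0 < A i j]
    (fun i => Num.truncn (b i 0 / A i j)); last by exists i.
  by apply/card_gt0P; exists i0.
by rewrite /minn; case: ifP.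
Qed.

Lemma vcoord_row (R : realType) (n : nat) (a : 'M[R]_(1, n)) (b : 'cV[R]_1)
    (j : 'I_n) :
  0 < a 0 j -> vcoord a b j = Num.truncn (b 0 0 / a 0 j).
Proof.
move=> aj; have [|i _] := @vcoord_attained _ _ _ a b j; first by exists 0.
by rewrite (ord1 i).
Qed.

(** * Maxima over finite sets of points *)

Lemma set_max_eq (R : realType) (S : set R) (x : R) :
  S x -> ubound S x -> set_max S = x.
Proof.
move=> Sx Ux; apply: xget_unique => // y [Sy Uy].
by apply/le_anti; rewrite Ux // Uy.
Qed.

Lemma finite_argmax (R : realType) (T : eqType) (f : T -> R) (S : set T) :
  finite_set S -> S !=set0 -> exists2 x, S x & forall y, S y -> f y <= f x.
Proof.
move=> /finite_seqP[s ->]; elim: s => [|x s IH]; first by case.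
move=> _; case: s IH => [_|y s IH].
  by exists x => [|z]; rewrite /= inE // => /eqP->.
have [|z zs zmax] := IH; first by exists y; rewrite /= mem_head.
have [xz|/ltW zx] := leP (f x) (f z).
  exists z => [|w]; first by rewrite /= inE zs orbT.
  by rewrite /= inE => /orP[/eqP-> //|/zmax].
exists x => [|w]; first by rewrite /= mem_head.
by rewrite /= inE => /orP[/eqP-> //|/zmax/le_trans->].
Qed.

(** On a finite nonempty set the default value of [set_max] never enters: [max_value] is a true
    maximum. *)
Lemma max_valueP (R : realType) (n : nat) (c : 'rV[R]_n) (S : set 'cV[nat]_n) :
  finite_set S -> S !=set0 ->
  exists2 x, S x & max_value c S = objective c x
    /\ forall y, S y -> objective c y <= objective c x.
Proof.
move=> fS S0; have [x Sx xmax] := finite_argmax (objective c) fS S0.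
exists x => //; split=> //; apply: set_max_eq; first by exists x.
by move=> _ [y Sy <-]; exact: xmax.
Qed.

Lemma max_value_vpoints (R : realType) (m n : nat) (A : 'M[R]_(m, n))
    (b : 'cV[R]_m) (c : 'rV[R]_n) :
  (0 < n)%N ->
  exists2 j, max_value c (vpoints A b) = c 0 j * (vcoord A b j)%:R
    & forall k, c 0 k * (vcoord A b k)%:R <= max_value c (vpoints A b).
Proof.
move=> n_gt0; have [||_ [j _ <-] [-> jmax]] := @max_valueP _ _ c (vpoints A b).
- exact/finite_image/finite_finset.
- by exists (vpoint A b (Ordinal n_gt0)), (Ordinal n_gt0).
exists j; first by rewrite objective_vpoint.
by move=> k; rewrite -objective_vpoint; apply: jmax; exists k.
Qed.

Lemma feasible_finite (R : realType) (m n : nat) (A : 'M[R]_(m, n))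
    (b : 'cV[R]_m) :
  (forall i j, 0 <= A i j) -> (forall j, exists i, 0 < A i j) ->
  finite_set (feasible A b).
Proof.
move=> A0 Apos.
(* One bound for all coordinates of all feasible points; pairs with zero entry contribute 0, as
   division by zero yields 0. *)
pose B := (\max_(p : 'I_m * 'I_n) Num.truncn (b p.1 0 / A p.1 p.2)%R)%N.
pose h (g : {ffun 'I_n -> 'I_B.+1}) : 'cV[nat]_n := \col_j (g j : nat).
apply: (@sub_finite_set _ _ (range h)); last exact/finite_image/finite_finset.
move=> x /feasibleE xL.
have xB j : (x j 0%R < B.+1)%N.
  have [i Aij] := Apos j.
  rewrite ltnS; apply: leq_trans (leq_bigmax (i, j)) => /=.
  have Ax : A i j * (x j 0)%:R <= b i 0.
    apply: le_trans (xL i); rewrite (bigD1 j) //= lerDl.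
    by apply: sumr_ge0 => k _; rewrite mulr_ge0.
  have xle : (x j 0)%:R <= b i 0 / A i j by rewrite ler_pdivlMr // mulrC.
  by rewrite truncn_ge_nat // (le_trans _ xle).
exists [ffun j => Ordinal (xB j)] => //.
by apply/colP => j; rewrite mxE ffunE.
Qed.

Lemma feasible0 (R : realType) (m n : nat) (A : 'M[R]_(m, n)) (b : 'cV[R]_m) :
  (forall i, 0 <= b i 0) -> feasible A b (const_mx 0%N).
Proof.
by move=> b0; apply/feasibleE => i; rewrite big1 // => j _; rewrite mxE mulr0.
Qed.

Lemma max_value_feasible (R : realType) (m n : nat) (A : 'M[R]_(m, n))
    (b : 'cV[R]_m) (c : 'rV[R]_n) :
  (forall i j, 0 <= A i j) -> (forall i, 0 <= b i 0) ->
  (forall j, exists i, 0 < A i j) ->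
  exists2 x, feasible A b x & max_value c (feasible A b) = objective c x
    /\ forall y, feasible A b y -> objective c y <= objective c x.
Proof.
move=> A0 b0 Apos; apply: max_valueP; first exact: feasible_finite.
by exists (const_mx 0%N); exact: feasible0.
Qed.

Lemma max_value_vpoints_ge0 (R : realType) (m n : nat) (A : 'M[R]_(m, n))
    (b : 'cV[R]_m) (c : 'rV[R]_n) :
  (0 < n)%N -> (forall j, 0 <= c 0 j) -> 0 <= max_value c (vpoints A b).
Proof.
by move=> n0 c0; have [j -> _] := @max_value_vpoints _ _ _ A b c n0; rewrite mulr_ge0.
Qed.

(** * Working with the infimum *)

Lemma alpha_le (R : realType) (m n : nat) (A : 'M[R]_(m, n)) (b : 'cV[R]_m)
    (c : 'rV[R]_n) :
  (0 < n)%N -> admissible A b c -> alpha R m n <= precision A b c.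
Proof.
move=> n0 adm; apply: ge_inf; last by exists A, b, c.
exists 0 => _ [A' [b' [c' [[_ _ c'0 _ M0] ->]]]].
by rewrite divr_ge0 ?max_value_vpoints_ge0 // ltW.
Qed.

Lemma le_alpha (R : realType) (m n : nat) (r : R) :
  (0 < m)%N -> (0 < n)%N ->
  (forall (A : 'M[R]_(m, n)) b c, admissible A b c -> r <= precision A b c) ->
  r <= alpha R m n.
Proof.
move=> m0 n0 H; apply: lb_le_inf; last by move=> _ [A [b [c [/H + ->]]]].
(* The all-ones instance shows that the infimum is over a nonempty set: a unit vector is feasible
   with value 1, so the optimum is positive. *)
pose A : 'M[R]_(m, n) := const_mx 1; pose b : 'cV[R]_m := const_mx 1.
pose c : 'rV[R]_n := const_mx 1.
have A0 i j : 0 <= A i j by rewrite mxE.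
have b0 i : 0 <= b i 0 by rewrite mxE.
have Apos j : exists i, 0 < A i j by exists (Ordinal m0); rewrite mxE.
exists (precision A b c), A, b, c; split=> //; split=> // [j|]; first by rewrite mxE.
have [x _ [-> xmax]] := @max_value_feasible _ _ _ A b c A0 b0 Apos.
pose y : 'cV[nat]_n := \col_j (j == Ordinal n0 : nat).
have sumy : \sum_j 1 * (y j 0)%:R = 1 :> R.
  rewrite (bigD1 (Ordinal n0)) //= mxE eqxx mul1r big1 ?addr0 // => j /negbTE jn.
  by rewrite mxE jn mulr0.
have yL : feasible A b y.
  apply/feasibleE => i; rewrite [b _ _]mxE -[leRHS]sumy.
  by apply: ler_sum => j _; rewrite mxE.
apply: lt_le_trans (xmax _ yL); rewrite objectiveE.
by under eq_bigr do rewrite mxE; rewrite sumy.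
Qed.

Lemma alpha_ge0 (R : realType) (m n : nat) :
  (0 < m)%N -> (0 < n)%N -> 0 <= alpha R m n.
Proof.
move=> m0 n0; apply: le_alpha => // A b c [_ _ c0 _ M0].
by rewrite divr_ge0 ?max_value_vpoints_ge0 // ltW.
Qed.

(** * The two bounds relating m rows to one row *)

(* Assign each column to a row attaining its vcoord. The columns assigned to
   row i form a one-row instance with the same vertex coordinates, so they
   contribute at most max_V / alpha_1n to the optimum. *)
Lemma alpha_lower (R : realType) (m n : nat) :
  (0 < m)%N -> (0 < n)%N -> alpha R 1 n / m%:R <= alpha R m n.
Proof.
move=> m0 n0; apply: le_alpha => // A b c [A0 b0 c0 Apos M0].
have [x xL [Mx _]] := @max_value_feasible _ _ _ A b c A0 b0 Apos.
rewrite /precision; set V := max_value c (vpoints A b).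
have [_ _ Vmax] := @max_value_vpoints _ _ _ A b c n0.
have V0 : 0 <= V by exact: max_value_vpoints_ge0.
have /choice[r rP] : forall j, exists i,
    0 < A i j /\ vcoord A b j = Num.truncn (b i 0 / A i j).
  by move=> j; have [i] := @vcoord_attained _ _ _ A b j (Apos j); exists i.
(* Summing this over the m rows gives [alpha R 1 n] times the optimum at most m times [V]. *)
suff H i : alpha R 1 n * (\sum_(j | r j == i) c 0 j * (x j 0)%:R) <= V.
  rewrite ler_pdivrMr ?ltr0n // mulrAC ler_pdivlMr // Mx objectiveE.
  rewrite (partition_big r xpredT) //= mulr_sumr.
  apply: le_trans (ler_sum _ (fun i _ => H i)) _.
  by rewrite sumr_const card_ord mulr_natr.
(* Columns assigned elsewhere keep a positive weight, for admissibility, but have cost 0. *)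
pose a : 'M[R]_(1, n) := \row_j (if r j == i then A i j else 1).
pose d : 'cV[R]_1 := const_mx (b i 0).
pose e : 'rV[R]_n := \row_j (if r j == i then c 0 j else 0).
pose y : 'cV[nat]_n := \col_j (if r j == i then x j 0 else 0%N).
have a_gt0 k j : 0 < a k j.
  by rewrite mxE; case: eqP => // <-; exact: (rP j).1.
have a0 k j : 0 <= a k j by exact: ltW.
have d0 k : 0 <= d k 0 by rewrite mxE.
have e0 j : 0 <= e 0 j by rewrite mxE; case: ifP.
have apos j : exists k, 0 < a k j by exists 0.
have [z _ [Mz zmax]] := @max_value_feasible _ _ _ a d e a0 d0 apos.
have yL : feasible a d y.
  apply/feasibleE => k; rewrite [d _ _]mxE; move/feasibleE/(_ i): xL.
  apply: le_trans; apply: ler_sum => j _; rewrite !mxE; case: ifP => // _.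
  by rewrite mulr0 mulr_ge0.
have -> : \sum_(j | r j == i) c 0 j * (x j 0)%:R = objective e y.
  rewrite objectiveE big_mkcond; apply: eq_bigr => j _.
  by rewrite !mxE; case: ifP; rewrite ?mul0r.
apply: le_trans (ler_wpM2l (alpha_ge0 R _ n0) (zmax _ yL)) _ => //.
(* A group with zero optimum is not admissible, but its bound is trivial. *)
have [M'0|M'0] := leP (objective e z) 0.
  by apply: le_trans V0; rewrite mulr_ge0_le0 ?alpha_ge0.
have adm : admissible a d e by split=> //; rewrite Mz.
have := alpha_le n0 adm; rewrite /precision Mz ler_pdivlMr // => /le_trans; apply.
have [j -> _] := @max_value_vpoints _ _ _ a d e n0.
apply: le_trans (Vmax j); rewrite vcoord_row // !mxE.
have [ri|_] := eqP; last by rewrite mul0r mulr_ge0.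
by rewrite (rP j).2 ri.
Qed.

(** Terms off the image of [g] vanish, and on the image [f] inverts [g]. This turns sums over all
    columns into sums over pairs (copy, variable). *)
Lemma sum_pcancel (R : nmodType) (I J : finType) (f : J -> option I)
    (g : I -> J) (F : I -> R) :
  pcancel g f -> ocancel f g ->
  \sum_j (if f j is Some p then F p else 0) = \sum_p F p.
Proof.
move=> gK fK; rewrite (bigID (fun j => f j)) /= [X in _ + X]big1 ?addr0; last first.
  by move=> j; case: (f j).
rewrite (reindex_omap g f) => [|j]; last by have := fK j; case: (f j) => //= p ->.
by apply: eq_big => p; rewrite gK ?eqxx.
Qed.

(* m diagonal copies of a one-row instance; the columns left over are given
   cost 0. *)
Lemma alpha_upper (R : realType) (m n k : nat) :
  (0 < m)%N -> (0 < k)%N -> (m * k <= n)%N ->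
  alpha R m n <= alpha R 1 k / m%:R.
Proof.
move=> m0 k0 mkn; have n0 : (0 < n)%N by apply: leq_trans mkn; rewrite muln_gt0 m0.
rewrite ler_pdivlMr ?ltr0n //; apply: le_alpha => // a b c [a0 b0 c0 apos M0].
have {}apos t : 0 < a 0 t by have [i] := apos t; rewrite (ord1 i).
have mkn' : (#|{: 'I_m * 'I_k}| <= n)%N by rewrite card_prod !card_ord.
(* [g] places variable [p.2] of copy [p.1] among the n columns; its partial inverse [f] is [None] on
   leftover columns. *)
pose g (p : 'I_m * 'I_k) := widen_ord mkn' (enum_rank p).
have g_inj : injective g.
  by move=> p q /(congr1 val) /= /val_inj/enum_rank_inj.
pose f j := [pick p | g p == j].
have fK : ocancel f g by move=> j; rewrite /f; case: pickP => //= p /eqP.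
have gK : pcancel g f.
  move=> p; rewrite /f; case: pickP => [q /eqP/g_inj->//|/(_ p)].
  by rewrite eqxx.
have [x xL [Mx _]] := @max_value_feasible _ _ _ a b c a0 b0 (fun t => ex_intro _ 0 (apos t)).
(* The entry 1 in leftover columns gives each of them a positive entry. *)
pose A : 'M[R]_(m, n) :=
  \matrix_(i, j) if f j is Some p then (if p.1 == i then a 0 p.2 else 0) else 1.
pose B : 'cV[R]_m := const_mx (b 0 0).
pose C : 'rV[R]_n := \row_j (if f j is Some p then c 0 p.2 else 0).
pose X : 'cV[nat]_n := \col_j (if f j is Some p then x p.2 0 else 0%N).
have A0 i j : 0 <= A i j by rewrite mxE; case: (f j) => // p; case: ifP.
have B0 i : 0 <= B i 0 by rewrite mxE.
have C0 j : 0 <= C 0 j by rewrite mxE; case: (f j).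
have Apos j : exists i, 0 < A i j.
  case fj: (f j) => [p|]; last by exists (Ordinal m0); rewrite mxE fj.
  by exists p.1; rewrite mxE fj eqxx.
have XL : feasible A B X.
  apply/feasibleE => i; rewrite [B _ _]mxE.
  pose F (p : 'I_m * 'I_k) := (if p.1 == i then a 0 p.2 else 0) * (x p.2 0)%:R.
  rewrite (eq_bigr (fun j => if f j is Some p then F p else 0)); last first.
    by move=> j _; rewrite !mxE; case: (f j); rewrite ?mulr0.
  rewrite (sum_pcancel _ gK fK) -(pair_bigA _ (fun i t => F (i, t))) /=.
  rewrite (bigD1 i) //= [X in _ + X]big1 ?addr0 => [|i' /negbTE ii'].
    by move/feasibleE/(_ 0): xL; under eq_bigr do rewrite /F /= eqxx.
  by rewrite big1 // => t _; rewrite /F /= ii' mul0r.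
have CX : objective C X = m%:R * objective c x.
  rewrite !objectiveE.
  rewrite (eq_bigr (fun j => if f j is Some p then c 0 p.2 * (x p.2 0)%:R else 0));
    last by move=> j _; rewrite !mxE; case: (f j); rewrite ?mulr0.
  rewrite (sum_pcancel _ gK fK) -(pair_bigA _ (fun _ t => c 0 t * (x t 0)%:R)) /=.
  by rewrite sumr_const card_ord mulr_natl.
have [Y _ [MY Ymax]] := @max_value_feasible _ _ _ A B C A0 B0 Apos.
have MXY : m%:R * max_value c (feasible a b) <= max_value C (feasible A B).
  by rewrite MY Mx -CX; exact: Ymax.
have MY0 : 0 < max_value C (feasible A B).
  by apply: lt_le_trans MXY; rewrite mulr_gt0 ?ltr0n.
have adm : admissible A B C by split.
have V0 : 0 <= max_value c (vpoints a b) by exact: max_value_vpoints_ge0.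
apply: (@le_trans _ _ (precision A B C * m%:R)).
  by rewrite ler_wpM2r // alpha_le.
(* After clearing denominators, two comparisons remain: the best vertex value does not grow, and the
   optimum grows by a factor at least m ([MXY]). *)
rewrite /precision ler_pdivlMr // -[_ * m%:R * _]mulrA mulrAC.
rewrite ler_pdivrMr //; apply: ler_pM => //; first exact: max_value_vpoints_ge0.
  by rewrite mulr_ge0 // ltW.
have [_ _ Vmax] := @max_value_vpoints _ _ _ a b c k0.
have [j -> _] := @max_value_vpoints _ _ _ A B C n0.
(* A leftover vertex has value 0; any other is bounded through row [p.1], whose quotient is that of
   the one-row instance. *)
case fj: (f j) => [p|]; last by rewrite mxE fj mul0r.
rewrite mxE fj; apply: le_trans (Vmax p.2).
rewrite ler_wpM2l // ler_nat vcoord_row //.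
have Apj : A p.1 j = a 0 p.2 by rewrite mxE fj eqxx.
by have := @vcoord_le _ _ _ A B p.1 j; rewrite Apj [B _ _]mxE; apply.
Qed.

(** * Passage to the limit *)

Lemma alpha1_cvg (R : realType) : alpha R 1 n @[n --> \oo] --> alpha1_infty R.
Proof.
(* Monotonicity is claimed only from index 1, since [alpha R 1 0] is the conventional value 0. *)
apply: (@near_nonincreasing_is_cvgn _ _ 0).
  exists 1%N => // n /= n1 k nk.
  by have := @alpha_upper R 1 k n; rewrite mul1n divr1; apply.
by exists 1%N => // n /= n1; rewrite alpha_ge0.
Qed.

Theorem corollary3 (R : realType) (m : nat) (hm : (0 < m)%N) :
  alpha R m n @[n --> \oo] --> alpha1_infty R / m%:R.
Proof.
apply: (@squeeze_cvgr _ _ _ _ (fun n => alpha R 1 n / m%:R)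
  (fun n => alpha R 1 (n %/ m) / m%:R)).
(* For n at least m, [n %/ m] is positive and m copies of that many columns fit into n. *)
- exists m => // n /= mn.
  rewrite alpha_lower ?(leq_trans hm) //= alpha_upper ?divn_gt0 //.
  by rewrite mulnC leq_trunc_div.
- by apply: cvgMl; exact: alpha1_cvg.
- apply: cvgMl; apply: (@cvg_comp _ _ _ (fun n => n %/ m)%N (alpha R 1)); last exact: alpha1_cvg.
  apply/cvgnyPge => N; exists (N * m)%N => // n /=.
  by rewrite leq_divRL.
Qed.
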